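(* Let $0<p<1$ be a constant. Then $$\lim_{n\to\infty}\Pr\big[\chi_d(G)=\chi(G)\big]=1 \quad\text{for } G\sim\mathcal{G}(n,p),$$ i.e., almost all graphs in $\mathcal{G}(n,p)$ have the same chromatic number and dynamic chromatic number.
   Context: All graphs are finite and simple. $\mathcal{G}(n,p)$ is the Erdős–Rényi random graph on vertex set $[n]=\{1,\dots,n\}$ in which each pair of vertices is joined independently with probability $p$. A dynamic coloring of a graph $G$ is a proper vertex coloring such that every vertex of degree at least $2$ has neighbors of at least two different colors. The dynamic chromatic number $\chi_d(G)$ is the smallest number of colors in a dynamic coloring of $G$; $\chi(G)$ is the usual chromatic number. *)

(* Defs.v *)
From HB Require Import structures.
From mathcomp Require Import all_boot all_order all_algebra.
From mathcomp Require Import reals.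
Import Order.TTheory GRing.Theory Num.Theory.

Set Implicit Arguments.
Unset Strict Implicit.
Unset Printing Implicit Defensive.

Record sgraph (T : finType) := SGraph {
  edges : {set {set T}};
  edges_card2 : [forall e in edges, #|e| == 2] }.

HB.instance Definition _ (T : finType) := [isSub for @edges T].
HB.instance Definition _ (T : finType) := [Finite of sgraph T by <:].

Section Coloring.
Variables (T : finType) (G : sgraph T).

Definition adj (u v : T) : bool := [set u; v] \in edges G.

Definition nbhd (v : T) : {set T} := [set u | adj v u].

Definition degree (v : T) : nat := #|nbhd v|.

Definition proper_coloring (k : nat) (c : {ffun T -> 'I_k}) : bool :=
  [forall u, forall v, adj u v ==> (c u != c v)].

Definition dynamic_coloring (k : nat) (c : {ffun T -> 'I_k}) : bool :=
  proper_coloring c &&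
  [forall v, (2 <= degree v) ==> (2 <= #|c @: nbhd v|)].

Definition colorable (k : nat) : bool :=
  [exists c : {ffun T -> 'I_k}, proper_coloring c].

Definition dyn_colorable (k : nat) : bool :=
  [exists c : {ffun T -> 'I_k}, dynamic_coloring c].

Lemma adj_irrefl (v : T) : ~~ adj v v.
Proof.
rewrite /adj setUid; apply/negP => vG.
by have /forallP/(_ [set v]) := edges_card2 G; rewrite vG cards1.
Qed.

Lemma adj_sym (u v : T) : adj u v = adj v u.
Proof. by rewrite /adj setUC. Qed.

(* Giving every vertex its own color is a dynamic coloring. *)
Lemma ex_dyn_colorable : exists k, dyn_colorable k.
Proof.
exists #|T|; apply/existsP; exists [ffun v => enum_rank v].
have injc : injective [ffun v : T => enum_rank v].
  by move=> x y; rewrite !ffunE => /enum_rank_inj.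
apply/andP; split.
  apply/forallP => u; apply/forallP => v; apply/implyP => uv.
  apply: contraTneq uv => /injc ->; exact: adj_irrefl.
by apply/forallP => v; apply/implyP; rewrite (card_imset _ injc).
Qed.

Lemma ex_colorable : exists k, colorable k.
Proof.
have [k /existsP[c /andP[cP _]]] := ex_dyn_colorable.
by exists k; apply/existsP; exists c.
Qed.

Definition chi : nat := ex_minn ex_colorable.

Definition chi_d : nat := ex_minn ex_dyn_colorable.

End Coloring.

Section RandomGraph.
Local Open Scope ring_scope.
Variables (R : realType) (n : nat) (p : R).

(* The pairs of vertices are joined independently, so the probability of a
   given graph is a product over all pairs e. The vertices are 0, ..., n - 1. *)
Definition gnp (G : sgraph 'I_n) : R :=
  \prod_(e : {set 'I_n} | #|e| == 2)
     (if e \in edges G then p else 1 - p).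

Definition gnp_Pr (A : pred (sgraph 'I_n)) : R := \sum_(G | A G) gnp G.

Lemma gnp_ge0 (G : sgraph 'I_n) : 0 <= p <= 1 -> 0 <= gnp G.
Proof.
by case/andP=> p0 p1; apply: prodr_ge0 => e _; case: ifP; rewrite ?subr_ge0.
Qed.

Lemma gnp_PrT : gnp_Pr predT = 1.
Proof.
pose F (e : {set 'I_n}) := if #|e| == 2 then p else 0.
pose F' (e : {set 'I_n}) := if #|e| == 2 then 1 - p else 1.
have <- : \prod_e (F e + F' e) = 1.
  by rewrite big1 // => e _; rewrite /F /F'; case: ifP => _; rewrite ?add0r ?subrKC.
rewrite bigA_distr (bigID (fun J : {set {set 'I_n}} => [forall e in J, #|e| == 2])) /=.
rewrite [X in _ + X]big1 => [|J]; last first.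
  case/forall_inPn => e eJ e2.
  by rewrite (bigD1 e) //= eJ /F (negPf e2) mul0r.
rewrite addr0 /gnp_Pr (reindex_omap (@edges 'I_n) insub) => [|J JP]; last first.
  by rewrite insubT.
apply: eq_big => [G|G _].
  by rewrite /= edges_card2 valK eqxx.
rewrite /gnp big_mkcond; apply: eq_bigr => e _; rewrite /F /F'.
case: ifP => // e2; case: ifP => // eG.
by have /forall_inP/(_ e eG) := edges_card2 G; rewrite e2.
Qed.

End RandomGraph.

(* Main.v *)
Require Import Defs.
From mathcomp Require Import all_boot all_order all_algebra.
From mathcomp Require Import all_classical all_reals all_analysis.
From mathcomp Require Import ring lra zify.
Import Order.TTheory GRing.Theory Num.Theory.
Import numFieldNormedType.Exports.

Set Implicit Arguments.
Unset Strict Implicit.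
Unset Printing Implicit Defensive.

Local Open Scope ring_scope.

(** If a vertex lies in a triangle, then in every proper coloring it has two
    neighbors of different colors; so if every vertex lies in a triangle, proper
    and dynamic colorings are the same thing. A fixed vertex v spans with about
    n/2 disjoint pairs of other vertices that many edge-disjoint triangles, whose
    presence in G(n,p) are independent events of probability p^3, so v is in no
    triangle with probability at most (1 - p^3)^((n-1)/2), and a union bound over
    v concludes. *)

Definition in_triangle (T : finType) (G : sgraph T) (v : T) : bool :=
  [exists x, exists y, [&& adj G v x, adj G v y & adj G x y]].

Lemma dyn_colorable_triangle (T : finType) (G : sgraph T) (k : nat) :
  [forall v, in_triangle G v] -> dyn_colorable G k = colorable G k.
Proof.
move=> /forallP tri; apply/existsP/existsP => -[c cP]; exists c.
  by case/andP: cP.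
rewrite /dynamic_coloring cP; apply/forallP => v; apply/implyP => _.
have /existsP[x /existsP[y /and3P[vx vy xy]]] := tri v.
have /forallP/(_ x)/forallP/(_ y) := cP; rewrite xy /= => cxy.
apply: leq_trans (_ : #|[set c x; c y]| <= _)%N; first by rewrite cards2 cxy.
by apply: subset_leq_card; rewrite finset.subUset !finset.sub1set !imset_f // inE.
Qed.

Lemma chi_d_eq_chi (T : finType) (G : sgraph T) :
  [forall v, in_triangle G v] -> chi_d G = chi G.
Proof.
move=> tri; rewrite /chi_d /chi.
case: ex_minnP => a; rewrite dyn_colorable_triangle // => Ga amin.
case: ex_minnP => b Gb bmin.
by apply/eqP; rewrite eqn_leq bmin // amin // dyn_colorable_triangle.
Qed.

(** Consecutive entries of [s] are paired off, a last unpaired one being dropped. Each triangle is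
    stored as its set of edges, so its presence in [G] is an inclusion in [edges G] and
    edge-disjointness is disjointness of sets. *)
Fixpoint triangles (T : finType) (v : T) (s : seq T) : seq {set {set T}} :=
  if s is x :: y :: s' then
    [set [set v; x]; [set v; y]; [set x; y]] :: triangles v s'
  else [::].

(** Induction two entries at a time, following the recursion of [triangles]. *)
Lemma seq_pair_ind (T : Type) (P : seq T -> Prop) :
  P [::] -> (forall x, P [:: x]) -> (forall x y s, P s -> P (x :: y :: s)) ->
  forall s, P s.
Proof.
move=> P0 P1 P2 s; suff [] : P s /\ forall x, P (x :: s) by [].
by elim: s => [|y s [Ps IH]]; split=> // x; exact: P2.
Qed.

Lemma size_triangles (T : finType) (v : T) (s : seq T) :
  size (triangles v s) = (size s)./2.
Proof. by elim/seq_pair_ind: s => //= x y s ->. Qed.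

Lemma triangles_pairs (T : finType) (v : T) (s : seq T) : uniq (v :: s) ->
  all (fun D : {set {set T}} => [forall e in D, #|e| == 2]) (triangles v s).
Proof.
elim/seq_pair_ind: s => //= x y s IH.
rewrite !inE !negb_or => /and3P[/and3P[vx vy vs] /andP[xy xs] /andP[ys us]].
rewrite IH ?vs // andbT; apply/forall_inP => e; rewrite !inE -orbA.
by case/or3P => /eqP ->; rewrite cards2 ?vx ?vy ?xy.
Qed.

Lemma card_triangles (T : finType) (v : T) (s : seq T) (D : {set {set T}}) :
  uniq (v :: s) -> D \in triangles v s -> #|D| = 3.
Proof.
elim/seq_pair_ind: s => //= x y s IH.
rewrite !inE !negb_or => /and3P[/and3P[vx vy vs] /andP[xy xs] /andP[ys us]].
case/predU1P => [->|]; last by apply: IH; rewrite vs.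
have vxNvy : [set v; x] != [set v; y].
  by apply/eqP => /finset.setP/(_ x); rewrite !inE eqxx orbT eq_sym (negPf vx) (negPf xy).
have vxNxy : [set v; x] != [set x; y].
  by apply/eqP => /finset.setP/(_ v); rewrite !inE eqxx (negPf vx) (negPf vy).
have vyNxy : [set v; y] != [set x; y].
  by apply/eqP => /finset.setP/(_ v); rewrite !inE eqxx (negPf vx) (negPf vy).
by rewrite -finset.setUA finset.cardsU1 cards2 !inE negb_or vxNvy vxNxy vyNxy.
Qed.

(** All the triangles share [v], so edges of different triangles are told apart by an endpoint in
    [s]. *)
Lemma triangles_meet (T : finType) (v : T) (s : seq T) (D : {set {set T}}) (e : {set T}) :
  D \in triangles v s -> e \in D -> exists2 z, z \in s & z \in e.
Proof.
elim/seq_pair_ind: s => //= x y s IH; rewrite inE => /predU1P[->|Ds eD].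
  rewrite !inE -orbA => /or3P[]/eqP->; [exists x|exists y|exists x];
    by rewrite !inE eqxx ?orbT.
by have [z zs ze] := IH Ds eD; exists z; rewrite // !inE zs !orbT.
Qed.

Lemma triangles_disjoint (T : finType) (v : T) (s : seq T) : uniq (v :: s) ->
  pairwise (fun D D' : {set {set T}} => [disjoint D & D']) (triangles v s).
Proof.
elim/seq_pair_ind: s => //= x y s IH.
rewrite !inE !negb_or => /and3P[/and3P[vx vy vs] /andP[xy xs] /andP[ys us]].
rewrite IH ?vs // andbT; apply/allP => D Ds; rewrite disjoint_subset.
(* A common edge would lie inside [{v, x, y}] and also contain some [z] of [s], but none of [v],
   [x], [y] occurs in [s]. *)
apply/fintype.subsetP => e eD; rewrite inE; apply/negP => /(triangles_meet Ds)[z zs].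
apply/negP; apply: contraTN zs.
by move: eD; rewrite !inE -orbA => /or3P[]/eqP->; rewrite !inE => /orP[]/eqP->.
Qed.

Lemma not_in_triangle_avoid (T : finType) (G : sgraph T) (v : T) (s : seq T) :
  ~~ in_triangle G v ->
  all (fun D : {set {set T}} => ~~ (D \subset edges G)) (triangles v s).
Proof.
move=> vG; elim/seq_pair_ind: s => //= x y s ->; rewrite andbT.
apply: contra vG => /fintype.subsetP sub.
apply/existsP; exists x; apply/existsP; exists y.
by apply/and3P; split; apply: sub; rewrite !inE eqxx ?orbT.
Qed.

Section RandomGraph.
Variables (R : realType) (n : nat) (p : R).
Implicit Types (G : sgraph 'I_n) (S D : {set {set 'I_n}}).

Lemma gnp_Pr_subset S : [forall e in S, #|e| == 2] ->
  gnp_Pr p (fun G => S \subset edges G) = p ^+ #|S|.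
Proof.
move=> /forall_inP S2.
(* [F] and [F'] are the weights of [e] being present and absent. Expanding the product of
   [F e + F' e] gives a sum over all families [J] of vertex sets. The zeros of [F] kill every [J]
   that contains a non-pair, and those of [F'] every [J] that misses an element of [S]; the
   surviving terms are the graphs containing [S]. *)
pose F (e : {set 'I_n}) := if #|e| == 2 then p else 0.
pose F' (e : {set 'I_n}) :=
  if e \in S then 0 else if #|e| == 2 then 1 - p else 1.
have <- : \prod_e (F e + F' e) = p ^+ #|S|.
  rewrite -prodr_const [RHS]big_mkcond; apply: eq_bigr => e _; rewrite /F /F'.
  case: (boolP (e \in S)) => [/S2 ->|_]; first by rewrite addr0.
  by case: ifP => _; rewrite ?add0r ?subrKC.
rewrite bigA_distr.
rewrite (bigID (fun J : {set {set 'I_n}} => [forall e in J, #|e| == 2])) /=.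
rewrite [X in _ + X]big1 => [|J]; last first.
  case/forall_inPn => e eJ e2.
  by rewrite (bigD1 e) //= eJ /F (negPf e2) mul0r.
rewrite addr0 (reindex_omap (@edges 'I_n) insub) => [|J JP]; last first.
  by rewrite insubT.
rewrite /gnp_Pr big_mkcond; apply: eq_big => [G|G _].
  by rewrite /= edges_card2 valK eqxx.
case: ifPn => [/fintype.subsetP SG|/subsetPn[e eS eG]]; last first.
  by rewrite (bigD1 e) //= (negPf eG) /F' eS mul0r.
rewrite /gnp big_mkcond; apply: eq_bigr => e _; rewrite /F /F'.
case: ifP => e2; case: ifP => // eG.
- by case: ifP => // /SG; rewrite eG.
- by have /forall_inP/(_ e eG) := edges_card2 G; rewrite e2.
- by case: ifP => // /S2; rewrite e2.
Qed.

(* The induction on [Ds] uses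
   Pr(S in G, D not in G, ...) = Pr(S in G, ...) - Pr(S and D in G, ...),
   which is why the event [S \subset edges G] has to be carried along. *)
Lemma gnp_Pr_avoid (Ds : seq {set {set 'I_n}}) S :
  all (fun D => [forall e in D, #|e| == 2]) (S :: Ds) ->
  pairwise (fun D D' => [disjoint D & D']) (S :: Ds) ->
  gnp_Pr p (fun G => (S \subset edges G) &&
                     all (fun D => ~~ (D \subset edges G)) Ds)
  = p ^+ #|S| * \prod_(D <- Ds) (1 - p ^+ #|D|).
Proof.
elim: Ds S => [|D Ds IH] S /=.
  rewrite big_nil mulr1 andbT => S2 _; rewrite -gnp_Pr_subset //.
  by apply: eq_bigl => G; rewrite andbT.
case/and3P => S2 D2 Ds2 /andP[/andP[SD SDs] /andP[DDs pDs]].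
have SUD2 : [forall e in S :|: D, #|e| == 2].
  apply/forall_inP => e; rewrite finset.in_setU.
  by case/orP; [move/forall_inP: S2; apply|move/forall_inP: D2; apply].
have SUDs : all (fun D' => [disjoint S :|: D & D']) Ds.
  apply/allP => D' D'Ds; rewrite disjoint_sym finset.disjoints_subset finset.setCU.
  rewrite finset.subsetI -!finset.disjoints_subset ![[disjoint D' & _]]disjoint_sym.
  by apply/andP; split; [exact: (allP SDs)|exact: (allP DDs)].
have ES := IH S; rewrite /= S2 Ds2 SDs pDs in ES.
have ESD := IH (S :|: D); rewrite /= SUD2 Ds2 SUDs pDs in ESD.
have SDcard : #|S :|: D| = (#|S| + #|D|)%N.
  by apply/eqP; rewrite (leq_card_setU S D).
rewrite big_cons mulrBl mul1r mulrBr -ES // mulrA -exprD -SDcard -ESD //.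
rewrite /gnp_Pr [X in _ = X - _](bigID (fun G => D \subset edges G)) /=.
under [X in _ = X + _ - _]eq_bigl do rewrite andbAC -finset.subUset.
rewrite addrAC subrr add0r; apply: eq_bigl => G.
by rewrite [in RHS]andbAC andbA.
Qed.

Lemma gnp_Pr_le (A B : pred (sgraph 'I_n)) : 0 <= p <= 1 ->
  (forall G, A G -> B G) -> gnp_Pr p A <= gnp_Pr p B.
Proof.
move=> p01 AB; rewrite /gnp_Pr big_mkcond [leRHS]big_mkcond.
apply: ler_sum => G _; case: ifPn => [/AB ->//|_].
by case: ifP => // _; exact: gnp_ge0.
Qed.

Lemma gnp_Pr_union (A : 'I_n -> pred (sgraph 'I_n)) : 0 <= p <= 1 ->
  gnp_Pr p (fun G => [exists v, A v G]) <= \sum_v gnp_Pr p (A v).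
Proof.
move=> p01; rewrite /gnp_Pr; under [leRHS]eq_bigr do rewrite big_mkcond.
rewrite exchange_big big_mkcond; apply: ler_sum => G _ /=.
have A0 w : 0 <= if A w G then gnp p G else 0 by case: ifP => // _; exact: gnp_ge0.
case: existsP => [[v Av]|_]; last exact: sumr_ge0.
by rewrite (bigD1 v) //= Av lerDl sumr_ge0.
Qed.

Lemma gnp_PrC (A : pred (sgraph 'I_n)) :
  gnp_Pr p A = 1 - gnp_Pr p (fun G => ~~ A G).
Proof. by rewrite -(gnp_PrT n p) /gnp_Pr [in RHS](bigID A) /= addrK. Qed.

Lemma gnp_Pr_not_in_triangle (v : 'I_n) : 0 <= p <= 1 ->
  gnp_Pr p (fun G => ~~ in_triangle G v) <= (1 - p ^+ 3) ^+ (n.-1)./2.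
Proof.
move=> p01; pose s := enum (predC1 v).
have us : uniq (v :: s) by rewrite /= mem_enum !inE eqxx enum_uniq.
have ss : size s = n.-1 by rewrite -cardE cardC1 card_ord.
(* The empty set serves as [S] in [gnp_Pr_avoid]: its inclusion is no constraint and its factor is
   1. *)
have -> : (1 - p ^+ 3) ^+ (n.-1)./2 =
    p ^+ #|@finset.set0 {set 'I_n}| * \prod_(D <- triangles v s) (1 - p ^+ #|D|).
  rewrite cards0 mul1r -ss -(size_triangles v) big_seq.
  rewrite (eq_bigr (fun=> 1 - p ^+ 3)) => [|D Ds]; last by rewrite (card_triangles us).
  by rewrite -big_seq big_const_seq count_predT iter_mulr_1.
rewrite -gnp_Pr_avoid /=.
- apply: gnp_Pr_le => // G vG.
  by rewrite finset.sub0set not_in_triangle_avoid.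
- by rewrite triangles_pairs // andbT; apply/forall_inP => e; rewrite inE.
rewrite triangles_disjoint // andbT; apply/allP => D _.
by rewrite finset.disjoints_subset finset.sub0set.
Qed.

End RandomGraph.

(** With [t = m * x], this combines [(1 - x) ^ m <= exp (- t)] and [t ^ 2 <= 2 * exp t]. Decay of
    order [1 / m ^ 2] is enough to beat the factor [n] of the union bound. *)
Lemma expr_onem_le (R : realType) (x : R) (m : nat) : 0 <= x <= 1 ->
  (m%:R * x) ^+ 2 * (1 - x) ^+ m <= 2.
Proof.
case/andP=> x0 x1; have mx0 : 0 <= m%:R * x by rewrite mulr_ge0.
have le_exp : (1 - x) ^+ m <= expR (- (m%:R * x)).
  by rewrite -mulrN expRM_natl lerXn2r ?nnegrE ?subr_ge0 ?expR_ge0 ?expR_ge1Dx.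
have : (m%:R * x) ^+ 2 <= 2 * expR (m%:R * x).
  by have := expR_ge1Dxn 1 mx0; rewrite (_ : 2`!%:R = 2 :> R) //; lra.
rewrite -(ler_pM2r (expR_gt0 (- (m%:R * x)))) -[leRHS]mulrA -expRD subrr expR0 mulr1.
by apply: le_trans; rewrite ler_wpM2l // sqr_ge0.
Qed.

Local Open Scope classical_set_scope.

Theorem theorem1 (R : realType) (p : R) (p_gt0 : 0 < p) (p_lt1 : p < 1) :
  (fun n : nat => gnp_Pr p (fun G : sgraph 'I_n => chi_d G == chi G))
    @ \oo --> (1 : R).
Proof.
have p01 : 0 <= p <= 1 by rewrite !ltW.
have y01 : 0 <= p ^+ 3 <= 1 by rewrite exprn_ge0 ?exprn_ile1 ?ltW.
have y_gt0 : 0 < p ^+ 3 by rewrite exprn_gt0.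
set y := p ^+ 3 in y01 y_gt0.
(* 72 is 36 * 2: below, [n * n.+1 <= 36 * m ^ 2] and [(m * y) ^ 2 * q <= 2], while [harmonic n] is
   the inverse of [n.+1]. *)
pose C := 72 / y ^+ 2.
apply: (@squeeze_cvgr _ _ _ _ (fun n => 1 - C * harmonic n) (cst 1)); last 2 first.
- rewrite -[X in _ --> X]subr0 -[X in 1 - X](mulr0 C).
  by apply: cvgB; [exact: cvg_cst|apply: cvgM; [exact: cvg_cst|exact: cvg_harmonic]].
- exact: cvg_cst.
near=> n; have n_ge3 : (3 <= n)%N by near: n; exact: nbhs_infty_ge.
apply/andP; split; last first.
  rewrite /cst -(gnp_PrT n p); exact: gnp_Pr_le.
rewrite gnp_PrC lerD2l lerN2.
pose bad (v : 'I_n) (G : sgraph 'I_n) := ~~ in_triangle G v.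
have bad_le : gnp_Pr p (fun G : sgraph 'I_n => chi_d G != chi G) <=
    n%:R * (1 - y) ^+ (n.-1)./2.
  apply: (@le_trans _ _ (gnp_Pr p (fun G => [exists v, bad v G]))).
    apply: gnp_Pr_le => // G; apply: contraR; rewrite negb_exists => tri.
    apply/eqP/chi_d_eq_chi/forallP => v; apply: negbNE; exact: (forallP tri).
  apply: le_trans (gnp_Pr_union _ p01) _.
  rewrite -[n in n%:R]card_ord mulr_natl -sumr_const.
  by apply: ler_sum => v _; exact: gnp_Pr_not_in_triangle.
apply: le_trans bad_le _.
(* This is where [3 <= n] enters: for smaller [n] there is no pair and [m] is 0. *)
set m := (n.-1)./2; have n_le : (n.+1 <= 6 * m)%N by rewrite /m; lia.
have := expr_onem_le m y01; set q := (1 - y) ^+ m => q_le.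
have q_ge0 : 0 <= q by rewrite exprn_ge0 // subr_ge0; case/andP: y01.
rewrite /= /C ler_pdivlMr // mulrAC ler_pdivlMr ?exprn_gt0 //.
apply: le_trans (_ : 36 * ((m%:R * y) ^+ 2 * q) <= _); last by lra.
have n1m : n.+1%:R <= 6 * m%:R :> R by rewrite -natrM ler_nat.
have nm : n%:R <= 6 * m%:R :> R by apply: le_trans n1m; rewrite ler_nat.
have nnm : n%:R * n.+1%:R <= 36 * m%:R ^+ 2 :> R.
  have -> : 36 * m%:R ^+ 2 = (6 * m%:R) * (6 * m%:R) :> R by ring.
  by rewrite ler_pM.
rewrite [leLHS](_ : _ = n%:R * n.+1%:R * (q * y ^+ 2)); last by ring.
rewrite [leRHS](_ : _ = 36 * m%:R ^+ 2 * (q * y ^+ 2)); last by ring.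
by rewrite ler_wpM2r // mulr_ge0 ?sqr_ge0.
Unshelve. all: by end_near.
Qed.
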